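(* Let $Q$ be a connected component of a stratum of the moduli space $Q_g$ of unit-area holomorphic quadratic differentials on a compact surface of genus $g\ge2$, and let $V_\delta:Q\to\mathbb{R}^+$, $0<\delta<1$, be a family of functions as in the context, with $C_{\delta,l}:=\{q:V_\delta(q)\le l\}$. Fix $0<\delta<1$. Then there is $\tau_0=\tau_0(\delta)>0$ such that for all $\tau>\tau_0$ there is $\tilde l_0=\tilde l_0(\delta,\tau)$ such that for all $l>\tilde l_0$ there is $\gamma=\gamma(l,\delta)<1$ such that for all $q\notin C_{\delta,l}$ and all $n\ge1$, the random walk $\{X_n\}$ with step $\tau$ satisfies $$P_q\big(X_j\notin C_{\delta,l}:\ 0\le j\le n\big)\le\frac{V_\delta(q)}{l}\,\gamma^n .$$
   Context: $Q_g$ is the moduli space of pairs $(M,\omega)$, $M$ a genus $g$ Riemann surface and $\omega$ a holomorphic quadratic differential on $M$ with $\int_M|\omega|=1$, up to biholomorphisms carrying one differential to the other. Integrating $\omega$ gives an atlas of charts to $\mathbb{C}\cong\mathbb{R}^2$ (away from the zeros) with transition maps $z\mapsto\pm z+c$; $SL(2,\mathbb{R})$ acts on $Q_g$ by linear post-composition with these charts. $Q_g$ is stratified by integer partitions of $4g-4$ (orders of the zeros); each stratum has finitely many connected components, and these are $SL(2,\mathbb{R})$-invariant. $g_t=\begin{pmatrix}e^t&0\\0&e^{-t}\end{pmatrix}$, $r_\theta=\begin{pmatrix}\cos\theta&\sin\theta\\-\sin\theta&\cos\theta\end{pmatrix}$, $K=\{r_\theta:0\le\theta<2\pi\}$. $\nu$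 is the normalized Lebesgue (Haar) probability measure on $\theta\in[0,2\pi)$. For $\tau>0$ the random walk is the Markov chain $X_{n+1}=g_\tau r_{\theta_n}X_n$ with $\theta_0,\theta_1,\dots$ i.i.d. with law $\nu$; $P_q$ is probability given $X_0=q$. The functions $V_\delta:Q\to\mathbb{R}^+$ are smooth, proper (unbounded off compact sets), $K$-invariant and satisfy: (Logsmoothness) For all $x\in Q$, viewing $V_{\delta,x}(h):=V_\delta(hx)$, $h\in SL(2,\mathbb{R})$, as a function on $\mathbb{H}^2=SO(2)\backslash SL(2,\mathbb{R})$ (with base point $i$ the identity coset and hyperbolic distance $d$): for all $\sigma>1$ there is $\kappa>0$ such that for any $p\in\mathbb{H}^2$ with $d(p,i)<\kappa$ and any $h\in SL(2,\mathbb{R})$, $\sigma^{-1}V_{\delta,x}(h)\le V_{\delta,x}(ph)\le\sigma V_{\delta,x}(h)$. (Drift) For all $0<\delta<1$ there is $\tilde c=\tilde c(\delta)$ such that for all sufficiently large $\tau$ there is $\tilde b=\tilde b(\tau,\delta)$ such that for all $x\in Q$, $\int_0^{2\pi}V_\delta(g_\tau r_\theta x)\,d\nu(\theta)\le\tilde c e^{-(1-\delta)\tau}V_\delta(x)+\tilde b$. *)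

(* Defs.v *)
From HB Require Import structures.
From Stdlib Require Import Relation_Operators.
From mathcomp Require Import all_boot all_order all_algebra finmap.
From mathcomp Require Import complex.
From mathcomp Require Import all_classical all_reals all_analysis.

Set Implicit Arguments.
Unset Strict Implicit.
Unset Printing Implicit Defensive.

Import Order.TTheory GRing.Theory Num.Theory.
Import numFieldNormedType.Exports.

Local Open Scope classical_set_scope.
Local Open Scope ring_scope.

(* R[i] packed as a numClosedFieldType, so that it inherits the topology, norm
   and derivatives of MathComp-Analysis; [derivable f z 1] is then complex
   differentiability. *)
Definition CC (R : realType) : numClosedFieldType := R[i].

Definition mkC (R : realType) (x y : R) : CC R := Complex x y.
Definition reC (R : realType) (z : CC R) : R := complex.Re z.
Definition imC (R : realType) (z : CC R) : R := complex.Im z.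
Definition absC (R : realType) (z : CC R) : R := complex.Re `|z|.

Definition holo_at (R : realType) (f : CC R -> CC R) (z : CC R) : Prop :=
  derivable f z 1.

Section Genus.
Variable R : realType.

Definition cis (t : R) : CC R := mkC (cos t) (sin t).

(* The unit circle is cut into 4g arcs; this is the point with parameter t in
   [0, 1] on the k-th one. *)
Definition side (g k : nat) (t : R) : CC R :=
  cis (pi *+ 2 * (k%:R + t) / (4 * g)%:R).

(* Boundary word a_0 b_0 a_0^-1 b_0^-1 ... *)
Inductive side_pairing (g : nat) : CC R -> CC R -> Prop :=
| SidePairA j t : (j < g)%N -> 0 <= t <= 1 ->
    side_pairing g (side g (4 * j) t) (side g (4 * j + 2) (1 - t))
| SidePairB j t : (j < g)%N -> 0 <= t <= 1 ->
    side_pairing g (side g (4 * j + 1) t) (side g (4 * j + 3) (1 - t)).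

Definition closed_disc : set (CC R) := [set z | `|z| <= 1].

(* A compact-to-Hausdorff continuous surjection is a quotient map, so S is the
   4g-gon with its sides identified by [side_pairing]. *)
Definition genus_surface (g : nat) (S : topologicalType) : Prop :=
  hausdorff_space S /\
  exists f : CC R -> S,
    [/\ {within closed_disc, continuous f},
        f @` closed_disc = setT &
        forall z z', closed_disc z -> closed_disc z' ->
          f z = f z' <-> clos_refl_sym_trans (CC R) (side_pairing g) z z'].

End Genus.

Definition homeomorphism (S T : topologicalType) (F : S -> T) : Prop :=
  continuous F /\
  exists G : T -> S, [/\ continuous G, cancel F G & cancel G F].

Section QuadraticDifferentials.
Variables (R : realType) (S : ptopologicalType).

(* Only the values of [coord] on [dom] and of [coordV] on [coord @` dom] are
   meaningful. *)
Record chart := Chart {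
  dom : set S ;
  coord : S -> CC R ;
  coordV : CC R -> S ;
  open_dom : open dom ;
  open_codom : open (coord @` dom) ;
  coordK : forall p, dom p -> coordV (coord p) = p ;
  coord_continuous : forall p, dom p -> {for p, continuous coord} ;
  coordV_continuous : forall p, dom p -> {for coord p, continuous coordV}
}.

(* A Riemann surface structure on S (an atlas with holomorphic transition maps)
   with a holomorphic quadratic differential, equal to [coef c z dz^2] in the
   chart c. The atlas need not be maximal: [biholomorphic] below identifies
   compatible atlases. *)
Record qdiff := QDiff {
  atlas : set chart ;
  coef : chart -> CC R -> CC R ;
  atlas_cover : forall p, exists2 c, atlas c & dom c p ;
  atlas_holo : forall c c' p, atlas c -> atlas c' -> dom c p -> dom c' p ->
    holo_at (coord c' \o coordV c) (coord c p) ;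
  coef_holo : forall c p, atlas c -> dom c p -> holo_at (coef c) (coord c p) ;
  coef_change : forall c c' p, atlas c -> atlas c' -> dom c p -> dom c' p ->
    coef c (coord c p) =
    coef c' (coord c' p) * derive1 (coord c' \o coordV c) (coord c p) ^+ 2
}.

Definition biholomorphic (X Y : qdiff) : Prop :=
  exists2 F : S -> S, homeomorphism F &
    forall c c' p, atlas X c -> atlas Y c' -> dom c p -> dom c' (F p) ->
      holo_at (coord c' \o F \o coordV c) (coord c p) /\
      coef X c (coord c p) = coef Y c' (coord c' (F p)) *
        derive1 (coord c' \o F \o coordV c) (coord c p) ^+ 2.

Definition borel := g_sigma_algebraType (@open S).

(* The measure |omega|, i.e. |coef c| dx dy in every chart c *)
Definition is_area_measure (X : qdiff)
    (mu : {measure set borel -> \bar R}) : Prop :=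
  forall (c : chart) (E : set S), atlas X c -> measurable (E : set borel) ->
    E `<=` dom c ->
    mu E = (\int[(@lebesgue_measure R \x @lebesgue_measure R)%E]_(z in
              [set z : R * R | (coord c @` E) (mkC z.1 z.2)])
              (absC (coef X c (mkC z.1 z.2)))%:E)%E.

Definition unit_area (X : qdiff) : Prop :=
  exists2 mu : {measure set borel -> \bar R},
    is_area_measure X mu & mu setT = 1%E.

(* [zero_order X p 0] says that p is not a zero. *)
Definition zero_order (X : qdiff) (p : S) (n : nat) : Prop :=
  exists c : chart, [/\ atlas X c, dom c p &
    exists h : CC R -> CC R,
      h (coord c p) != 0 /\
      \forall z \near coord c p,
        holo_at h z /\ coef X c z = (z - coord c p) ^+ n * h z].

Definition has_zeros (X : qdiff) (kappa : seq nat) : Prop :=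
  exists zs : 'I_(size kappa) -> S,
    [/\ injective zs,
        forall i, zero_order X (zs i) (nth 0%N kappa i) &
        forall p n, (0 < n)%N -> zero_order X p n -> exists i, p = zs i].

(* w is a local primitive of a square root of omega. Injectivity keeps U away
   from the zeros of omega. Flat charts with connected domains are unique up to
   z |-> +-z + c. *)
Definition flat_chart (X : qdiff) (U : set S) (w : S -> CC R) : Prop :=
  [/\ open U, (forall x y, U x -> U y -> w x = w y -> x = y) &
    forall c p, atlas X c -> dom c p -> U p ->
      holo_at (w \o coordV c) (coord c p) /\
      derive1 (w \o coordV c) (coord c p) ^+ 2 = coef X c (coord c p)].

Definition preserves_zeros (X Y : qdiff) (F : S -> S) : Prop :=
  forall p n, zero_order X p n <-> zero_order Y (F p) n.

Definition lin (h : 'M[R]_2) (z : CC R) : CC R :=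
  mkC (h ord0 ord0 * reC z + h ord0 ord_max * imC z)
      (h ord_max ord0 * reC z + h ord_max ord_max * imC z).

(* Up to the homeomorphism F, the flat charts of Y are those of X composed
   with h. *)
Definition post_composed (h : 'M[R]_2) (X Y : qdiff) : Prop :=
  exists F : S -> S,
    [/\ homeomorphism F, preserves_zeros X Y F &
      forall p, zero_order X p 0 ->
        exists (U : set S) (w w' : S -> CC R),
          [/\ U p, flat_chart X U w, flat_chart Y (F @` U) w' &
              forall x, U x -> w' (F x) = lin h (w x)]].

Definition near_isometry (e : R) (X Y : qdiff) (F : S -> S) : Prop :=
  [/\ homeomorphism F, preserves_zeros X Y F &
    forall p, zero_order X p 0 ->
      exists (U : set S) (w w' : S -> CC R),
        [/\ U p, flat_chart X U w, flat_chart Y (F @` U) w' &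
            forall x y, U x -> U y ->
              absC ((w' (F x) - w' (F y)) - (w x - w y))
                <= e * absC (w x - w y)]].

Record moduli := Moduli {
  class : set qdiff ;
  classP : exists2 X, unit_area X & class = [set Y | biholomorphic X Y]
}.

HB.instance Definition _ := gen_eqMixin moduli.
HB.instance Definition _ := gen_choiceMixin moduli.

Definition moduli_ball (q : moduli) (e : R) : set moduli :=
  [set q' | exists X Y F, [/\ class q X, class q' Y & near_isometry e X Y F]].

Definition moduli_open (U : set moduli) : Prop :=
  forall q, U q -> exists2 e : R, 0 < e & moduli_ball q e `<=` U.

Lemma near_isometryW e e' X Y F :
  e <= e' -> near_isometry e X Y F -> near_isometry e' X Y F.
Proof.
move=> ee' [hF zF nF]; split=> // p /nF[U [w [w' [Up fw fw' H]]]].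
exists U, w, w'; split=> // x y Ux Uy; apply: le_trans (H x y Ux Uy) _.
apply: ler_wpM2r => //; rewrite /absC.
by have := normr_ge0 (w x - w y); case: `|_| => a b; rewrite lecE => /andP[].
Qed.

Lemma moduli_ballW q e e' : e <= e' -> moduli_ball q e `<=` moduli_ball q e'.
Proof.
move=> ee' q' [X [Y [F [qX qY n]]]].
exists X, Y, F; exact: And3 qX qY (near_isometryW ee' n).
Qed.

Lemma moduli_openT : moduli_open setT.
Proof. by move=> q _; exists 1. Qed.

Lemma moduli_openI : setI_closed moduli_open.
Proof.
move=> A B oA oB q [Aq Bq].
have [a a0 qa] := oA q Aq; have [b b0 qb] := oB q Bq.
exists (Num.min a b); first by rewrite lt_min a0 b0.
move=> q' qq'; split.
  by apply: qa; apply: (moduli_ballW _ qq'); rewrite ge_min lexx.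
by apply: qb; apply: (moduli_ballW _ qq'); rewrite ge_min lexx orbT.
Qed.

Lemma moduli_open_bigU (I : Type) (f : I -> set moduli) :
  (forall i, moduli_open (f i)) -> moduli_open (\bigcup_i f i).
Proof.
move=> of_ q [i _ fiq]; have [e e0 qe] := of_ i q fiq.
by exists e => // q' /qe; exists i.
Qed.

(* On a stratum this is the topology given by period coordinates: moving the
   periods slightly is realized by a piecewise affine near isometry, and
   conversely a near isometry moves the periods of a fixed set of arcs only
   slightly. Near isometries preserve the orders of zeros, so every stratum is
   open and closed here; the topology is only ever restricted to strata. *)
HB.instance Definition _ := isOpenTopological.Build moduli
  moduli_openT moduli_openI moduli_open_bigU.

Definition stratum (kappa : seq nat) : set moduli :=
  [set q | exists2 X, class q X & has_zeros X kappa].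

Definition stratum_component (kappa : seq nat) (Q : set moduli) : Prop :=
  exists2 q, stratum kappa q & Q = connected_component (stratum kappa) q.

Fixpoint Ck (m k : nat) (f : 'rV[R]_m -> R) : Prop :=
  if k is k'.+1
  then (forall x, differentiable f x) /\ forall v, Ck k' (fun x => 'D_v f x)
  else continuous f.

Definition smooth m (f : 'rV[R]_m -> R) : Prop := forall k, Ck k f.

(* z is the period, determined up to sign, of a square root of omega along the
   path c : [0, 1] -> S, whose interior avoids the zeros: w is a continuous
   choice of flat coordinate along c. *)
Definition is_period (X : qdiff) (c : R -> S) (z : CC R) : Prop :=
  exists w : R -> CC R,
    [/\ {within `[0, 1], continuous w}, z = w 1 - w 0 &
      forall s, 0 < s < 1 ->
        exists (U : set S) (u : S -> CC R),
          [/\ U (c s), flat_chart X U u & \forall r \near s, w r = u (c r)]].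

Definition arc_between_zeros (X : qdiff) (c : R -> S) : Prop :=
  [/\ {within `[0, 1], continuous c},
      ~ zero_order X (c 0) 0, ~ zero_order X (c 1) 0 &
      forall s, 0 < s < 1 -> zero_order X (c s) 0].

(* A family, with a fixed marking by S, on which the period coordinates depend
   smoothly on the parameter *)
Definition smooth_family m (X : 'rV[R]_m -> qdiff) : Prop :=
  (forall t0 (e : R), 0 < e ->
    \forall t \near t0, near_isometry e (X t0) (X t) id) /\
  (forall c : R -> S, (forall t, arc_between_zeros (X t) c) ->
    exists P : 'rV[R]_m -> CC R,
      [/\ smooth (fun t => reC (P t)), smooth (fun t => imC (P t)) &
          forall t, is_period (X t) c (P t)]).

(* Smoothness on the orbifold Q, tested on the smooth maps R^m -> Q *)
Definition smooth_on (Q : set moduli) (f : moduli -> R) : Prop :=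
  forall m (X : 'rV[R]_m -> qdiff) (q : 'rV[R]_m -> moduli),
    smooth_family X -> (forall t, class (q t) (X t)) -> (forall t, Q (q t)) ->
    smooth (f \o q).

Definition SL2 : set 'M[R]_2 := [set h | \det h = 1].

(* The values of [act] outside [SL2] are irrelevant; on [SL2] these conditions
   determine it. *)
Record is_SL2_action (act : 'M[R]_2 -> moduli -> moduli) : Prop := {
  act_flat : forall h q X, SL2 h -> class q X ->
    exists2 Y, class (act h q) Y & post_composed h X Y ;
  act1 : forall q, act 1%:M q = q ;
  actM : forall h k q, SL2 h -> SL2 k -> act (h *m k) q = act h (act k q)
}.

End QuadraticDifferentials.

Section RandomWalk.
Variable R : realType.

Definition mx2 (a b c d : R) : 'M[R]_2 :=
  \matrix_(i, j) if i == ord0 then (if j == ord0 then a else b)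
                 else (if j == ord0 then c else d).

Definition geo (t : R) : 'M[R]_2 := mx2 (expR t) 0 0 (expR (- t)).
Definition rot (t : R) : 'M[R]_2 := mx2 (cos t) (sin t) (- sin t) (cos t).

Definition mobius (h : 'M[R]_2) (z : CC R) : CC R :=
  (mkC (h ord0 ord0) 0 * z + mkC (h ord0 ord_max) 0) /
  (mkC (h ord_max ord0) 0 * z + mkC (h ord_max ord_max) 0).

Definition arcosh (x : R) : R := ln (x + Num.sqrt (x ^+ 2 - 1)).

Definition hyp_dist (z w : CC R) : R :=
  arcosh (1 + absC (z - w) ^+ 2 / (2 * imC z * imC w)).

(* SO(2) p |-> p^-1 . i identifies SO(2) \ SL(2, R) with the upper half-plane
   and sends the identity coset to i. *)
Definition coset_pt (p : 'M[R]_2) : CC R := mobius (invmx p) (mkC 0 1).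

Lemma twopi_gt0 : (0 : R) < pi *+ 2.
Proof. by rewrite mulrn_wgt0// pi_gt0. Qed.

(* Uniform on [0, 2 pi]; the endpoints carry no mass. *)
Definition nu : probability (measurableTypeR R) R := uniform_prob twopi_gt0.

Definition independent d (Omega : measurableType d) (P : probability Omega R)
    (theta : nat -> {RV P >-> R}) : Prop :=
  forall (J : {fset nat}) (B : nat -> set R), (forall i, measurable (B i)) ->
    P (\bigcap_(i in [set` J]) (theta i @^-1` B i)) =
    (\prod_(i <- J) P (theta i @^-1` B i))%E.

Definition iid_nu d (Omega : measurableType d) (P : probability Omega R)
    (theta : nat -> {RV P >-> R}) : Prop :=
  independent theta /\
  forall n (B : set R), measurable B -> P (theta n @^-1` B) = nu B.

Variable S : ptopologicalType.
Variable act : 'M[R]_2 -> moduli R S -> moduli R S.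

Fixpoint walk (Omega : Type) (theta : nat -> Omega -> R) (tau : R)
    (q : moduli R S) (n : nat) (w : Omega) : moduli R S :=
  if n is n'.+1
  then act (geo tau *m rot (theta n' w)) (walk theta tau q n' w)
  else q.

Variable Q : set (moduli R S).

Definition sublevel (V : R -> moduli R S -> R) (delta l : R) :
    set (moduli R S) :=
  Q `&` [set q | V delta q <= l].

(* Only the values V delta q with 0 < delta < 1 and q in Q matter. *)
Record drift_family (V : R -> moduli R S -> R) : Prop := {
  V_gt0 : forall delta q, 0 < delta < 1 -> Q q -> 0 < V delta q ;
  V_smooth : forall delta, 0 < delta < 1 -> smooth_on Q (V delta) ;
  V_proper : forall delta l, 0 < delta < 1 -> compact (sublevel V delta l) ;
  V_rot : forall delta theta q, 0 < delta < 1 -> Q q ->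
    V delta (act (rot theta) q) = V delta q ;
  V_logsmooth : forall delta x, 0 < delta < 1 -> Q x ->
    forall sigma, 1 < sigma -> exists2 kappa : R, 0 < kappa &
      forall p h, SL2 p -> SL2 h ->
        hyp_dist (coset_pt p) (mkC 0 1) < kappa ->
        sigma^-1 * V delta (act h x) <= V delta (act (p *m h) x)
          <= sigma * V delta (act h x) ;
  V_drift : forall delta, 0 < delta < 1 ->
    exists c tau1 : R, forall tau, tau1 < tau ->
      exists b : R, forall x, Q x ->
        (\int[nu]_theta (V delta (act (geo tau *m rot theta) x))%:E <=
         (c * expR (- (1 - delta) * tau) * V delta x + b)%:E)%E
}.

End RandomWalk.

(* Main.v *)
(* For tau large, c e^{-(1 - delta) tau} <= 1/4, and when V(x) > l > 4 |b| the
   constant b is at most V(x) / 4; so off C_l the drift inequality reads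
   E V(X_1) <= V(X_0) / 2. Conditioning on the first n angles, the expectation of
   V(X_n) on the event {X_j not in C_l for j <= n} is therefore at most
   2^{-n} V(q), and Markov's inequality (V > l on that event) gives the bound
   with gamma = 1/2.
   The walk remains in Q because the orbits of the groups (g_t) and (r_t) are
   continuous paths in the stratum, and V(X_n) is measurable because logsmoothness
   controls the variation of V along SL(2, R)-orbits. *)
From HB Require Import structures.
Require Import Defs.
From mathcomp Require Import all_boot all_order all_algebra finmap.
From mathcomp Require Import complex.
From mathcomp Require Import all_classical all_reals all_analysis.
From mathcomp Require Import measurable_realfun.
From mathcomp Require Import ring lra.
Import Order.TTheory GRing.Theory Num.Theory.
Import numFieldNormedType.Exports.
Local Open Scope classical_set_scope.
Local Open Scope ring_scope.

Set Implicit Arguments.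
Unset Strict Implicit.
Unset Printing Implicit Defensive.

(** * Invariance of the components of a stratum *)

Section AbsC.
Variable R : realType.
Implicit Types (x y : R) (z : CC R).

Lemma absC_mk x y : absC (mkC x y) = Num.sqrt (x ^+ 2 + y ^+ 2).
Proof. by rewrite /absC /mkC normc_def. Qed.

Lemma ler_norm_absC x y : `|x| <= absC (mkC x y) /\ `|y| <= absC (mkC x y).
Proof.
by rewrite absC_mk -!sqrtr_sqr; split; apply: ler_wsqrtr;
  rewrite ?lerDl ?lerDr sqr_ge0.
Qed.

Lemma absC_le x y : absC (mkC x y) <= `|x| + `|y|.
Proof.
rewrite absC_mk -[leRHS]ger0_norm ?addr_ge0// -sqrtr_sqr; apply: ler_wsqrtr.
by rewrite sqrrD !real_normK ?num_real// lerD2r lerDl mulrn_wge0// mulr_ge0.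
Qed.

(** The two coordinates of the left side consist of four products of an entry of [h - 1] with a
    coordinate of [z - z'], each at most [e / 4] times [absC (z - z')]. *)
Lemma absC_lin_sub (h : 'M[R]_2) (e : R) z z' :
  (forall i j, `|h i j - 1%:M i j| <= e / 4) ->
  absC ((lin h z - lin h z') - (z - z')) <= e * absC (z - z').
Proof.
move=> he; case: z z' => [x y] [x' y'].
pose u := x - x'; pose v := y - y'.
have -> : Complex x y - Complex x' y' = mkC u v :> CC R by [].
have -> : lin h (Complex x y) - lin h (Complex x' y') - mkC u v =
    mkC ((h ord0 ord0 - 1) * u + h ord0 ord_max * v)
        (h ord_max ord0 * u + (h ord_max ord_max - 1) * v) :> CC R.
  rewrite /lin /mkC /= /u /v; apply/eqP.
  rewrite eq_complex /=; apply/andP; split; apply/eqP; ring.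
have [u_le v_le] := ler_norm_absC u v.
have := he ord0 ord0; have := he ord0 ord_max.
have := he ord_max ord0; have := he ord_max ord_max.
rewrite !mxE /= !subr0 => h11 h10 h01 h00.
apply: le_trans (absC_le _ _) _.
have B a b : `|a| <= e / 4 -> `|b| <= absC (mkC u v) ->
    `|a * b| <= e / 4 * absC (mkC u v).
  by move=> ? ?; rewrite normrM ler_pM.
apply: (@le_trans _ _ (4 * (e / 4 * absC (mkC u v)))); last first.
  by rewrite mulrA mulrCA divff ?mulr1// pnatr_eq0.
have -> (t : R) : 4 * t = (t + t) + (t + t) by ring.
by apply: lerD; apply: le_trans (ler_normD _ _) _; apply: lerD; exact: B.
Qed.

End AbsC.

Section Action.
Variables (R : realType) (S : ptopologicalType).
Variable act : 'M[R]_2 -> moduli R S -> moduli R S.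
Hypothesis act_SL2 : is_SL2_action act.

Lemma stratum_act kappa (h : 'M[R]_2) q :
  SL2 h -> stratum kappa q -> stratum kappa (act h q).
Proof.
move=> hh [X qX [zs [zsI zsX zsall]]].
have [Y qY [F [[_ [G [_ FG GF]]] zF _]]] := act_flat act_SL2 hh qX.
exists Y => //; exists (F \o zs); split.
- exact: inj_comp (can_inj FG) zsI.
- by move=> i; apply/zF.
- move=> p n n0; rewrite -{1}(GF p) => /zF /(zsall _ _ n0) [i Gp].
  by exists i; rewrite /= -Gp GF.
Qed.

(** The homeomorphism provided by [post_composed] is itself the near isometry: in flat coordinates
    it is [lin h], which [absC_lin_sub] compares with the identity. *)
Lemma moduli_ball_act (h : 'M[R]_2) q (e : R) : SL2 h ->
  (forall i j, `|h i j - 1%:M i j| <= e / 4) -> moduli_ball q e (act h q).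
Proof.
move=> hh he; have [X _ qX] := classP q.
(* [classP] describes the class as everything biholomorphic to [X]; the identity puts [X] itself
   there, by compatibility within its atlas. *)
have XX : class q X.
  rewrite qX /=; exists id.
    by do ?[split | exists id | move=> ? ?; exact].

  move=> c c' p cX c'X cp c'p; split; first exact: (atlas_holo cX c'X).
  exact: (coef_change cX c'X).
have [Y qY [F [hF zF flatF]]] := act_flat act_SL2 hh XX.
exists X, Y, F; split => //; split => // p /flatF [U [w [w' [Up Uw Uw' ww']]]].
exists U, w, w'; split => // x y Ux Uy; rewrite !ww'//.
exact: absC_lin_sub.
Qed.

Variables (kappa : seq nat) (Q : set (moduli R S)).
Hypothesis Q_comp : stratum_component kappa Q.

(* s |-> h s . q is a continuous path in the stratum, hence stays in one
   connected component. *)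
Lemma component_act (h : R -> 'M[R]_2) t q :
  (forall s, SL2 (h s)) -> h 0 = 1%:M -> {morph h : s t / s + t >-> s *m t} ->
  (forall i j, {for 0, continuous (fun s => h s i j)}) ->
  Q q -> Q (act (h t) q).
Proof.
move=> hSL h0 hM hc.
have cont : continuous (fun s => act (h s) q).
  move=> s U; rewrite nbhsE => -[V [oV Vs] VU].
  have [e e0 eV] := oV _ Vs.
  have hn i j : \forall r \near (0 : R), `|h r i j - 1%:M i j| <= e / 4.
    have e4 : 0 < e / 4 by rewrite divr_gt0.
    have /cvgr_dist_le /(_ _ e4) := hc i j.
    by apply: filterS => r; rewrite distrC h0.
  have {}hn : \forall r \near (0 : R), forall i j,
      `|h r i j - 1%:M i j| <= e / 4.
    have F : Filter (nbhs (0 : R)) by exact: nbhs_filter.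
    have hn' i := @filter_forall _ _ _ _ F (hn i).
    exact: (@filter_forall _ _ _ _ F hn').
  have {}hn : \forall r \near s, forall i j,
      `|h (r - s) i j - 1%:M i j| <= e / 4.
    rewrite (near_shift 0) subr0.
    by apply: filterS hn => r /=; rewrite addrK.
  apply: (filterS _ hn) => r hr; apply/VU/eV.
  (* The group law carries continuity from [0] to [s]: [act (h r) q] is [act (h s) q] moved by a
     matrix close to the identity. *)
  have -> : h r = h (r - s) *m h s by rewrite -hM subrK.
  rewrite (actM act_SL2)//.
  exact: moduli_ball_act.
case: Q_comp => q0 sq0 -> qq.
have sq := connected_component_sub qq.
apply: (connected_component_trans qq).
exists [set act (h s) q | s in setT]; last by exists t.
split.
- by exists 0 => //; rewrite h0 (act1 act_SL2).
- by move=> _ [s _ <-]; exact: stratum_act.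
- apply: connected_continuous_connected; last exact: continuous_subspaceT.
  exact/connected_intervalP.
Qed.

End Action.

(** * Independence *)

Section Independence.
Context d (Omega : measurableType d) (R : realType) (P : probability Omega R).
Variable G : set (set Omega).
Hypotheses (GI : setI_closed G) (GT : G setT) (Gm : G `<=` measurable).

Let GOmega : measurableType G.-sigma := g_sigma_algebraType G.

(** As functions of [A] both sides are finite measures, [P] restricted to [B] and [P] scaled by
    [P B]. They agree on the pi-system [G], which contains the whole space, hence on the
    sigma-algebra it generates. *)
Lemma independent_generated (B : set Omega) : measurable B ->
  (forall A, G A -> P (A `&` B) = (P A * P B)%E) ->
  forall A, <<s G >> A -> P (A `&` B) = (P A * P B)%E.
Proof.
move=> mB PAB A GA.
pose m2 := mscale (NngNum (fine_ge0 (measure_ge0 P B))) P.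
have m2E C : m2 C = (P C * P B)%E.
  by rewrite muleC -[P B]fineK// fin_num_measure.
rewrite -m2E -/(mrestr P mB A).
apply: (g_sigma_algebra_measure_unique G Gm (fun=> setT)) => //.
- by rewrite bigcup_const//; exists 0%N.
- by move=> C GC; exact: etrans (PAB C GC) (esym (m2E C)).
- move=> _; apply: le_lt_trans (ltry 1).
  exact: probability_le1 (measurableI _ _ measurableT mB).
Qed.

Lemma generated_measurable (A : set Omega) : <<s G >> A -> measurable A.
Proof.
by apply: smallest_sub => //; exact: sigma_algebra_measurable.
Qed.

Lemma measurable_fun_generated d' (T : measurableType d') (f : Omega -> T) :
  measurable_fun setT (f : GOmega -> T) -> measurable_fun setT f.
Proof.
move=> mf _ B mB; apply: generated_measurable.
exact: (mf measurableT B mB).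
Qed.

(* The freezing lemma: the law of (w, X w) on the product of the sigma-algebra
   generated by G with T is a product measure, so Fubini-Tonelli applies. *)
Lemma integral_independent d' (T : measurableType d') (X : Omega -> T)
    (m : probability T R) (f : GOmega * T -> \bar R) :
  measurable_fun setT X ->
  (forall A B, G A -> measurable B -> P (A `&` X @^-1` B) = (P A * m B)%E) ->
  measurable_fun setT f -> (forall z, (0 <= f z)%E) ->
  (\int[P]_w f (w, X w) = \int[P]_w \int[m]_t f (w, t))%E.
Proof.
move=> mX PGX mf f0.
(* The identity onto [Omega] with the coarser sigma-algebra; its distribution is the restriction of
   [P]. *)
pose i (w : Omega) : GOmega := w.
have mi : measurable_fun setT i.
  by move=> _ A mA; rewrite setTI; exact: generated_measurable.
have miX : measurable_fun setT (fun w => (i w, X w)).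
  exact: measurable_fun_pair.
pose I : {mfun Omega >-> GOmega} :=
  HB.pack i (isMeasurableFun.Build _ _ _ _ _ mi).
pose IX : {mfun Omega >-> (GOmega * T)%type} :=
  HB.pack (fun w => (i w, X w)) (isMeasurableFun.Build _ _ _ _ _ miX).
have PX B : measurable B -> P (X @^-1` B) = m B.
  by move=> mB; rewrite -[X in P X]setTI PGX// probability_setT mul1e.
(* Agreement on rectangles, which characterizes the product measure; [independent_generated] extends
   the hypothesis from [G] to all measurable [A]. *)
have law (A : set GOmega) B : measurable A -> measurable B ->
    distribution P IX (A `*` B) = (distribution P I A * m B)%E.
  move=> mA mB; rewrite -(PX B mB).
  apply: (@independent_generated (X @^-1` B)) => //.
    by rewrite -[X in measurable X]setTI; exact: mX.
  by move=> C GC; rewrite PGX// PX.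
transitivity (\int[distribution P IX]_z f z)%E.
  by rewrite ge0_integral_distribution.
transitivity (\int[distribution P I \x m]_z f z)%E.
  apply: eq_measure_integral => A mA _; apply/esym.
  exact: product_measure_unique.
rewrite fubini_tonelli1// ge0_integral_distribution//.
  exact: measurable_fun_fubini_tonelli_F.
by move=> w; exact: integral_ge0.
Qed.

End Independence.

(** * Measurability of V along the orbits *)

(** Second countability: [A] is open relative to [D], so its preimage is the union of the preimages
    of the countably many boxes, with rational centre and radius [1 / (k + 1)], whose trace on [D]
    lies in [A]. *)
Lemma measurable_relatively_open d (T : measurableType d) (R : realType) m n
    (N : T -> 'M[R]_(m, n)) (D A : set 'M[R]_(m, n)) :
  (forall i j, measurable_fun setT (fun x => N x i j)) ->
  (forall x, D (N x)) ->
  (forall M0, D M0 -> A M0 -> exists2 e : R, 0 < e & forall M, D M ->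
    (forall i j, `|M i j - M0 i j| < e) -> A M) ->
  measurable [set x | A (N x)].
Proof.
move=> mN DN oA.
pose box (p : 'M[rat]_(m, n) * nat) : set 'M[R]_(m, n) :=
  [set M | forall i j, `|M i j - ratr (p.1 i j)| < (p.2.+1%:R)^-1].
pose boxA p := [set x | box p (N x) /\ forall M, D M -> box p M -> A M].
have -> : [set x | A (N x)] = \bigcup_p boxA p.
  apply/seteqP; split => [x Ax|x [p _ [bN bA]]]; last exact: bA.
  have [e e0 eA] := oA _ (DN x) Ax.
  (* Twice the radius, since two points of a box are compared through its centre. *)
  have [k ke] : exists k, (k.+1%:R)^-1 + (k.+1%:R)^-1 < e :> R.
    have e2 : 0 < e / 2 by rewrite divr_gt0.
    have [k _ /(_ k (leqnn k)) /= ke] := near_infty_natSinv_lt (PosNum e2).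
    by exists k; rewrite [e]splitr ltrD.
  have cP i j : exists r : rat, `|N x i j - ratr r| < (k.+1%:R)^-1.
    have : N x i j - (k.+1%:R)^-1 < N x i j + (k.+1%:R)^-1.
      by rewrite ltrD2l gtrN// invr_gt0.
    move=> /rat_in_itvoo[r]; rewrite in_itv/= => /andP[? ?]; exists r.
    by rewrite ltr_distlC; apply/andP; split.
  pose c i j := xchoose (cP i j).
  have cN i j : `|N x i j - ratr (c i j)| < (k.+1%:R)^-1.
    exact: (xchooseP (cP i j)).
  exists (\matrix_(i, j) c i j, k) => //.
  split => [i j|M DM boxM]; first by rewrite mxE.
  apply: eA => // i j; apply: le_lt_trans ke.
  rewrite -(subrKA (ratr (c i j))); apply: le_trans (ler_normD _ _) _.
  apply: lerD; apply/ltW; first by have := boxM i j; rewrite mxE.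
  by rewrite distrC; exact: cN.
apply: countable_bigcupT_measurable => [|p]; first exact: countableP.
(* The second condition in [boxA] does not involve [x], so [boxA p] is either empty or the preimage
   of a whole box. *)
have [pA|npA] := pselect (forall M, D M -> box p M -> A M); last first.
  rewrite (_ : boxA p = set0)//; apply/seteqP; split => // x [_].
  by move/npA.
rewrite (_ : boxA p = \bigcap_(ij in [set: 'I_m * 'I_n])
    ((fun x => N x ij.1 ij.2) @^-1`
      ball (ratr (p.1 ij.1 ij.2) : R) (p.2.+1%:R)^-1)).
  apply: fin_bigcap_measurable => [|[i j] _]; first exact: finite_finset.
  by rewrite -[X in measurable X]setTI; apply: mN => //; exact: measurable_ball.
apply/seteqP; split => x /=.
  by move=> [bx _] [i j] _ /=; rewrite /ball/= distrC; exact: bx.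
by move=> bx; split => // i j; have := bx (i, j) I; rewrite /ball/= distrC.
Qed.

(** * Hyperbolic distance from the base point in terms of matrix entries *)

Section Hyperbolic.
Variables (R : realType).
Implicit Types (a b c d : R) (p M : 'M[R]_2).

Lemma mx2P p : p =
  mx2 (p ord0 ord0) (p ord0 ord_max) (p ord_max ord0) (p ord_max ord_max).
Proof.
by apply/matrixP => i j; rewrite mxE; case: (unliftP ord0 i) => [i'|] ->;
  case: (unliftP ord0 j) => [j'|] -> //; rewrite ?(ord1 i') ?(ord1 j') /=;
  congr (p _ _); apply/val_inj.
Qed.

Lemma mx2_mul a b c d a' b' c' d' : mx2 a b c d *m mx2 a' b' c' d' =
  mx2 (a * a' + b * c') (a * b' + b * d') (c * a' + d * c') (c * b' + d * d').
Proof.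
apply/matrixP => i j; rewrite !mxE big_ord_recl big_ord1 !mxE /=.
by case: ifP; case: ifP.
Qed.

Lemma det_mx2E a b c d : \det (mx2 a b c d) = a * d - b * c.
Proof.
rewrite (expand_det_row _ ord0) big_ord_recl big_ord1 /cofactor.
rewrite !det_mx11 !mxE /=.
by ring.
Qed.

Lemma mx2_1 : mx2 1 0 0 1 = 1%:M :> 'M[R]_2.
Proof. by rewrite [RHS]mx2P !mxE. Qed.

Lemma invmx2 a b c d : a * d - b * c = 1 ->
  invmx (mx2 a b c d) = mx2 d (- b) (- c) a.
Proof.
move=> D; have MV : mx2 d (- b) (- c) a *m mx2 a b c d = 1%:M.
  by rewrite mx2_mul -mx2_1; congr mx2; rewrite -?D; ring.
have u : mx2 a b c d \in unitmx by rewrite unitmxE det_mx2E D unitr1.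
by rewrite -[LHS]mul1mx -MV mulmxK.
Qed.

Lemma coset_ptE a b c d : a * d - b * c = 1 ->
  coset_pt (mx2 a b c d) =
  mkC (- (a * b + c * d) / (a ^+ 2 + c ^+ 2)) (a ^+ 2 + c ^+ 2)^-1.
Proof.
move=> D; rewrite /coset_pt invmx2// /mobius !mxE /=.
have n0 : a ^+ 2 + c ^+ 2 != 0.
  apply/negP; rewrite paddr_eq0 ?sqr_ge0// !sqrf_eq0 => /andP[/eqP a0 /eqP c0].
  by move: D; rewrite a0 c0 => /eqP; rewrite mul0r mulr0 subr0 eq_sym oner_eq0.
(* Clears the denominator [a - c i] of the Moebius map, nonzero because [a] and [c] cannot both
   vanish. *)
apply: (@mulIf _ (mkC a (- c))).
  apply/eqP => -[a0 /eqP]; rewrite oppr_eq0 => /eqP c0.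
  by move: n0; rewrite a0 c0 expr0n addr0 eqxx.
have -> : mkC (- c) 0 * mkC 0 1 + mkC a 0 = mkC a (- c) :> CC R.
  by apply/eqP; rewrite eq_complex /=; apply/andP; split; apply/eqP; ring.
rewrite divfK; last first.
  apply/eqP => -[a0 /eqP]; rewrite oppr_eq0 => /eqP c0.
  by move: n0; rewrite a0 c0 expr0n addr0 eqxx.
apply/eqP; rewrite eq_complex /=; apply/andP; split; apply/eqP.
  (* The determinant is written out in place of 1 so that the identity becomes formal in the
     entries. *)
  transitivity ((- (a * b + c * d) * a + (a * d - b * c) * c) /
    (a ^+ 2 + c ^+ 2)).
    by field.
  by rewrite D; field.
transitivity (((a * b + c * d) * c + (a * d - b * c) * a) / (a ^+ 2 + c ^+ 2)).
  by field.
by rewrite D; field.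
Qed.

(* That is, 2 cosh (dist (p^-1 . i, i)) is the squared Frobenius norm of p. *)
Lemma hyp_dist_coset a b c d : a * d - b * c = 1 ->
  hyp_dist (coset_pt (mx2 a b c d)) (mkC 0 1) =
  arcosh ((a ^+ 2 + b ^+ 2 + c ^+ 2 + d ^+ 2) / 2).
Proof.
move=> D; rewrite coset_ptE// /hyp_dist; congr arcosh.
have n0 : a ^+ 2 + c ^+ 2 != 0.
  apply/negP; rewrite paddr_eq0 ?sqr_ge0// !sqrf_eq0 => /andP[/eqP a0 /eqP c0].
  by move: D; rewrite a0 c0 => /eqP; rewrite mul0r mulr0 subr0 eq_sym oner_eq0.
rewrite [_ - mkC 0 1](_ : _ = mkC (- (a * b + c * d) / (a ^+ 2 + c ^+ 2))
    ((a ^+ 2 + c ^+ 2)^-1 - 1)); last first.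
  by apply/eqP; rewrite eq_complex /=; apply/andP; split; apply/eqP; ring.
rewrite absC_mk sqr_sqrtr ?addr_ge0 ?sqr_ge0// /imC /=.
(* Lagrange's identity, with [(a * d - b * c) ^+ 2] equal to 1. *)
have E : (a * b + c * d) ^+ 2 = (a ^+ 2 + c ^+ 2) * (b ^+ 2 + d ^+ 2) - 1.
  by rewrite -[1](expr1n _ 2) -{1}D; ring.
rewrite expr_div_n sqrrN E; field.
by [].
Qed.

End Hyperbolic.

(** * From logsmoothness to measurability in the matrix entries *)

Section LogSmooth.
Variable R : realType.

(** As [s <= 1], the root is at most [2 * s], so the argument of [ln] is at most
    [1 + 3 * s < 1 + k <= expR k]. *)
Lemma arcosh_lt (s k x : R) :
  0 < s <= 1 -> 4 * s <= k -> 1 <= x <= 1 + s ^+ 2 -> arcosh x < k.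
Proof.
move=> /andP[s0 s1] sk /andP[x1 xs].
have sq2 : Num.sqrt (x ^+ 2 - 1) <= 2 * s.
  rewrite -(@ger0_norm _ (2 * s)); last by rewrite mulr_ge0// ltW.
  rewrite -sqrtr_sqr; apply: ler_wsqrtr.
  have ss : s ^+ 2 <= 1 by rewrite expr_le1// ltW.
  have s2 : 0 <= s ^+ 2 by rewrite sqr_ge0.
  by nra.
have y0 : 0 < x + Num.sqrt (x ^+ 2 - 1).
  by rewrite ltr_pwDl ?sqrtr_ge0// (lt_le_trans ltr01).
have ss : s ^+ 2 <= s by rewrite expr2 ger_pMl.
rewrite /arcosh -ltr_expR lnK ?posrE//.
have := expR_ge1Dx k.
by lra.
Qed.

(** Converts entrywise closeness into the hyperbolic closeness required by logsmoothness. Here [p]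
    is [M] times the inverse of [M0], so [p - 1] is [(M - M0)] times that inverse, and its entries
    are small. *)
Lemma near_SL2 (M0 : 'M[R]_2) (k : R) : SL2 M0 -> 0 < k ->
  exists2 e : R, 0 < e & forall M, SL2 M ->
    (forall i j, `|M i j - M0 i j| < e) ->
    exists p, [/\ SL2 p, p *m M0 = M & hyp_dist (coset_pt p) (mkC 0 1) < k].
Proof.
rewrite (mx2P M0); set a := M0 _ _; set b := M0 _ _; set c := M0 _ _.
set d := M0 _ _; rewrite /SL2 /= det_mx2E => D k0.
pose s := Num.min 1 (k / 4).
have s0 : 0 < s by rewrite lt_min ltr01 divr_gt0.
have s1 : s <= 1 by rewrite ge_min lexx.
have sk : 4 * s <= k by rewrite mulrC -ler_pdivlMr// ge_min lexx orbT.
(* [K] dominates the sum of the absolute values of two entries of [M0]; dividing by it makes every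
   entry of [p - 1] at most [s ^+ 2 / 4]. *)
pose K := 1 + `|a| + `|b| + `|c| + `|d|.
have K0 : 0 < K by rewrite !ltr_pwDl.
exists (s ^+ 2 / 4 / K); first by rewrite !divr_gt0// exprn_gt0.
move=> M; rewrite (mx2P M) => DM MM0.
have := MM0 ord0 ord0; have := MM0 ord0 ord_max.
have := MM0 ord_max ord0; have := MM0 ord_max ord_max.
move: DM {MM0}; rewrite det_mx2E !mxE /=.
set a' := M ord0 ord0; set b' := M ord0 ord_max.
set c' := M ord_max ord0; set d' := M ord_max ord_max.
move=> D' dd cc bb aa.
have bnd x y u v : `|x| < s ^+ 2 / 4 / K -> `|y| < s ^+ 2 / 4 / K ->
    `|u| + `|v| <= K -> `|x * u - y * v| <= s ^+ 2 / 4.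
  move=> xe ye uv; apply: le_trans (ler_normB _ _) _; rewrite !normrM.
  apply: (@le_trans _ _ (s ^+ 2 / 4 / K * (`|u| + `|v|))).
    by rewrite mulrDr lerD// ler_wpM2r// ltW.
  by rewrite mulrAC ler_pdivrMr// ler_wpM2l// divr_ge0// sqr_ge0.
have [na nb nc nd] : [/\ 0 <= `|a|, 0 <= `|b|, 0 <= `|c| & 0 <= `|d|].
  by split.
have pA : `|(a' - a) * d - (b' - b) * c| <= s ^+ 2 / 4.
  by apply: bnd => //; rewrite /K; lra.
have pB : `|(b' - b) * a - (a' - a) * b| <= s ^+ 2 / 4.
  by apply: bnd => //; rewrite /K; lra.
have pC : `|(c' - c) * d - (d' - d) * c| <= s ^+ 2 / 4.
  by apply: bnd => //; rewrite /K; lra.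
have pD : `|(d' - d) * a - (c' - c) * b| <= s ^+ 2 / 4.
  by apply: bnd => //; rewrite /K; lra.
have Dp : (a' * d - b' * c) * (d' * a - c' * b) -
    (b' * a - a' * b) * (c' * d - d' * c) = 1.
  transitivity ((a' * d' - b' * c') * (a * d - b * c)); first by ring.
  by rewrite D D' mulr1.
exists (mx2 (a' * d - b' * c) (b' * a - a' * b)
            (c' * d - d' * c) (d' * a - c' * b)).
split.
- by rewrite det_mx2E.
- rewrite mx2_mul; congr mx2.
  + by transitivity (a' * (a * d - b * c)); [ring|rewrite D mulr1].
  + by transitivity (b' * (a * d - b * c)); [ring|rewrite D mulr1].
  + by transitivity (c' * (a * d - b * c)); [ring|rewrite D mulr1].
  + by transitivity (d' * (a * d - b * c)); [ring|rewrite D mulr1].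
rewrite hyp_dist_coset//; apply: (@arcosh_lt s) => //; first by rewrite s0.
have eA : a' * d - b' * c = 1 + ((a' - a) * d - (b' - b) * c).
  by rewrite -D; ring.
have eB : b' * a - a' * b = (b' - b) * a - (a' - a) * b by ring.
have eC : c' * d - d' * c = (c' - c) * d - (d' - d) * c by ring.
have eD : d' * a - c' * b = 1 + ((d' - d) * a - (c' - c) * b).
  by rewrite -D; ring.
(* Lower bound: by determinant 1, the squared Frobenius norm minus 2 equals
   [(A - E) ^+ 2 + (B + C) ^+ 2]. Upper bound: with [h = s ^+ 2 / 4 <= 1 / 4] the squared norm is at
   most [2 + 4 * h + 4 * h ^+ 2 <= 2 + 8 * h]. *)
apply/andP; split.
  rewrite ler_pdivlMr// mul1r.
  move: Dp; set A := a' * d - b' * c; set B := b' * a - a' * b.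
  set C := c' * d - d' * c; set E := d' * a - c' * b => Dp.
  have := sqr_ge0 (A - E); have := sqr_ge0 (B + C).
  by nra.
move: pA pB pC pD; rewrite eA eB eC eD.
move: ((a' - a) * d - _) ((b' - b) * a - _) ((c' - c) * d - _)
  ((d' - d) * a - _).
move=> A B C E; set h := s ^+ 2 / 4.
have h1 : 0 <= h <= 1 / 4.
  apply/andP; split; first by rewrite divr_ge0// sqr_ge0.
  by rewrite ler_wpM2r// expr_le1// ltW.
have sq x : `|x| <= h -> x ^+ 2 <= h ^+ 2.
  move=> xh; rewrite -real_normK ?num_real//.
  by rewrite lerXn2r// nnegrE (le_trans _ xh).
move=> Ah Bh Ch Eh; have := sq _ Ah; have := sq _ Bh; have := sq _ Ch.
have := sq _ Eh; move: Ah Eh => /ler_normlP[_ Ah] /ler_normlP[_ Eh].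
have hh : h ^+ 2 <= h / 4 by rewrite expr2; case/andP: h1 => ? ?; nra.
have -> : s ^+ 2 = 4 * h by rewrite /h; field.
by rewrite ler_pdivrMr// => ? ? ? ?; lra.
Qed.

Section Measurability.
Variables (S : ptopologicalType).
Variable act : 'M[R]_2 -> moduli R S -> moduli R S.
Hypothesis act_SL2 : is_SL2_action act.
Variables (Q : set (moduli R S)) (V : R -> moduli R S -> R).
Hypothesis V_family : drift_family act Q V.
Variables (delta : R).
Hypothesis delta01 : 0 < delta < 1.

(* Logsmoothness makes h |-> V (h q) upper semicontinuous on SL2. *)
Lemma measurable_V_act d (T : measurableType d) (N : T -> 'M[R]_2) q : Q q ->
  (forall i j, measurable_fun setT (fun x => N x i j)) ->
  (forall x, SL2 (N x)) ->
  measurable_fun setT (fun x => V delta (act (N x) q)).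
Proof.
move=> Qq mN NSL.
apply: (measurability _ (RGenCInfty.measurableE R)) => _ [_ [t ->] <-].
rewrite setTI [X in measurable X](_ : _ =
  ~` [set x | V delta (act (N x) q) < t]); last first.
  apply/seteqP; split => x /=; rewrite in_itv/= andbT leNgt; first by move/negP.
  by move=> /negP.
apply: measurableC.
pose A := [set M | V delta (act M q) < t].
rewrite -/[set x | A (N x)].
apply: (measurable_relatively_open (D := @SL2 R)) => // M0 SM0; rewrite /A /=.
set u := V _ _ => ut.
have near_u sigma : 1 < sigma -> exists2 e : R, 0 < e & forall M, SL2 M ->
    (forall i j, `|M i j - M0 i j| < e) ->
    sigma^-1 * u <= V delta (act M q) <= sigma * u.
  move=> /(V_logsmooth V_family delta01 Qq) [k k0 kV].
  have [e e0 eM] := near_SL2 SM0 k0; exists e => // M SM /(eM _ SM) [p [Sp <-]].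
  exact: kV.
(* Logsmoothness at [M0] itself with factor 2 reads [u / 2 <= u]; this avoids having to know that
   [act M0 q] lies in [Q]. *)
have u0 : 0 <= u.
  have [e e0 /(_ M0 SM0)] := near_u 2 (ltr1n _ 2).
  have h i j : `|M0 i j - M0 i j| < e by rewrite subrr normr0.
  by move=> /(_ h) /andP[+ _]; rewrite -/u; lra.
(* With this factor the upper bound is [u + (t - u) * u / (u + 1)], still below [t]; the [+ 1] keeps
   the denominator positive when [u = 0]. *)
have s1 : 1 < 1 + (t - u) / (u + 1).
  by rewrite ltrDl divr_gt0 ?subr_gt0// ltr_pwDr.
have [e e0 eM] := near_u _ s1; exists e => // M SM /(eM _ SM) /andP[_ le].
apply: le_lt_trans le _.
rewrite mulrDl mul1r -ltrBrDl mulrAC ltr_pdivrMr ?ltr_pwDr//.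
by rewrite ltr_pM2l ?subr_gt0// ltrDl.
Qed.

End Measurability.
End LogSmooth.

(** * The random walk *)

Section OneParameterGroups.
Variable R : realType.

Lemma mx2_continuous (a b c d : R -> R) :
  continuous a -> continuous b -> continuous c -> continuous d ->
  forall i j, continuous (fun s => mx2 (a s) (b s) (c s) (d s) i j).
Proof.
move=> ca cb cc cd i j.
rewrite (_ : (fun s => _) = if i == ord0 then if j == ord0 then a else b
                            else if j == ord0 then c else d).
  by case: ifP; case: ifP.
by apply/funext => s; rewrite mxE; case: ifP; case: ifP.
Qed.

Lemma geo_SL2 (t : R) : SL2 (geo t).
Proof. by rewrite /SL2 /= det_mx2E mulr0 subr0 -expRD subrr expR0. Qed.

Lemma rot_SL2 (t : R) : SL2 (Defs.rot t).
Proof. by rewrite /SL2 /= det_mx2E mulrN opprK -!expr2 cos2Dsin2. Qed.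

Lemma SL2_mul (h k : 'M[R]_2) : SL2 h -> SL2 k -> SL2 (h *m k).
Proof. by rewrite /SL2 /= => hh hk; rewrite det_mulmx hh hk mulr1. Qed.

Variables (S : ptopologicalType) (act : 'M[R]_2 -> moduli R S -> moduli R S).
Hypothesis act_SL2 : is_SL2_action act.
Variables (kappa : seq nat) (Q : set (moduli R S)).
Hypothesis Q_comp : stratum_component kappa Q.

(** [component_act] is applied to the two one-parameter groups in turn, rotation first. *)
Lemma component_geo_rot (s t : R) q : Q q -> Q (act (geo s *m Defs.rot t) q).
Proof.
move=> Qq; rewrite (actM act_SL2); [|exact: geo_SL2|exact: rot_SL2].
apply: (component_act (h := @geo R) act_SL2 Q_comp).
- exact: geo_SL2.
- by rewrite /geo oppr0 expR0 mx2_1.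
- by move=> a b; rewrite mx2_mul !(mulr0, mul0r, addr0, add0r) -!expRD -opprD.
- move=> i j; apply: mx2_continuous => r; try exact: cst_continuous.
    exact: continuous_expR.
  apply: continuous_comp; first exact: opp_continuous.
  exact: continuous_expR.
apply: (component_act (h := @Defs.rot R) act_SL2 Q_comp) => //.
- exact: rot_SL2.
- by rewrite /Defs.rot cos0 sin0 oppr0 mx2_1.
- move=> a b; rewrite /Defs.rot mx2_mul cosD sinD; congr mx2; ring.
- move=> i j; apply: mx2_continuous => r.
  + exact: continuous_cos.
  + exact: continuous_sin.
  + by apply: continuousN; exact: continuous_sin.
  + exact: continuous_cos.
Qed.

End OneParameterGroups.

(** * The walk as a random matrix product *)

Section Walk.
Variable R : realType.

(** The group element taking the starting point to the n-th position: measurability questions about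
    the walk become questions about real matrix entries. *)
Fixpoint walk_mx T (theta : nat -> T -> R) (tau : R) (n : nat) (w : T) :
    'M[R]_2 :=
  if n is k.+1 then geo tau *m Defs.rot (theta k w) *m walk_mx theta tau k w
  else 1%:M.

Lemma walk_mx_SL2 T (theta : nat -> T -> R) tau n w :
  SL2 (walk_mx theta tau n w).
Proof.
elim: n => [|n IH] /=; first exact: det1.
by apply: SL2_mul IH; apply: SL2_mul; [exact: geo_SL2|exact: rot_SL2].
Qed.

Lemma measurable_mulmx d (T : measurableType d) m n p
    (A : T -> 'M[R]_(m, n)) (B : T -> 'M[R]_(n, p)) :
  (forall i j, measurable_fun setT (fun x => A x i j)) ->
  (forall i j, measurable_fun setT (fun x => B x i j)) ->
  forall i j, measurable_fun setT (fun x => (A x *m B x) i j).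
Proof.
move=> mA mB i j; under eq_fun do rewrite mxE.
by apply: measurable_sum => k; exact: measurable_funM.
Qed.

Lemma measurable_rot d (T : measurableType d) (f : T -> R) :
  measurable_fun setT f ->
  forall i j, measurable_fun setT (fun x => Defs.rot (f x) i j).
Proof.
move=> mf.
have mcos : measurable_fun setT (fun x => cos (f x)).
  apply: measurableT_comp mf.
  by apply: continuous_measurable_fun; exact: continuous_cos.
have msin : measurable_fun setT (fun x => sin (f x)).
  apply: measurableT_comp mf.
  by apply: continuous_measurable_fun; exact: continuous_sin.
move=> i j; rewrite (_ : (fun x => _) =
    if i == ord0 then if j == ord0 then cos \o f else sin \o f
    else if j == ord0 then -%R \o (sin \o f) else cos \o f).
  by case: ifP => _; case: ifP => _ //; exact: measurableT_comp msin.
by apply/funext => x; rewrite mxE; case: ifP; case: ifP.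
Qed.

Lemma measurable_walk_mx d (T : measurableType d)
    (theta : nat -> T -> R) tau n :
  (forall i, (i < n)%N -> measurable_fun setT (theta i)) ->
  forall i j, measurable_fun setT (fun w => walk_mx theta tau n w i j).
Proof.
elim: n => [|n IH] mtheta i j /=; first exact: measurable_cst.
apply: measurable_mulmx => [{}i {}j|]; last first.
  by apply: IH => k /ltnW; exact: mtheta.
apply: measurable_mulmx => [{}i {}j|]; first exact: measurable_cst.
by apply: measurable_rot; exact: mtheta.
Qed.

Variables (S : ptopologicalType) (act : 'M[R]_2 -> moduli R S -> moduli R S).
Hypothesis act_SL2 : is_SL2_action act.

Lemma walkE T (theta : nat -> T -> R) tau q n w :
  walk act theta tau q n w = act (walk_mx theta tau n w) q.
Proof.
elim: n => [|n IH] /=; first by rewrite (act1 act_SL2).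
rewrite IH -(actM act_SL2) //; last exact: walk_mx_SL2.
by apply: SL2_mul; [exact: geo_SL2|exact: rot_SL2].
Qed.

End Walk.

(** * Events determined by the first n angles *)

Section Past.
Context (R : realType) d (Omega : measurableType d) (P : probability Omega R).
Variable theta : nat -> {RV P >-> R}.

(** Only the cylinders, not their sigma-algebra: a pi-system on which independence of the angles is
    directly a product formula. *)
Definition past (n : nat) : set (set Omega) :=
  [set A | exists2 B : nat -> set R, (forall i, measurable (B i)) &
    A = \bigcap_(i in `I_n) (theta i @^-1` B i)].

Lemma pastI n : setI_closed (past n).
Proof.
move=> _ _ [A mA ->] [B mB ->]; exists (fun i => A i `&` B i).
  by move=> i; exact: measurableI.
by rewrite -bigcapI.
Qed.

Lemma past_preimage n k (B : set R) : (k < n)%N -> measurable B ->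
  past n (theta k @^-1` B).
Proof.
move=> kn mB; exists (fun i => if i == k then B else setT).
  by move=> i; case: ifP.
apply/seteqP; split => [w Bw i _ /=|w]; first by case: eqP => // ->.
by move=> /(_ k kn); rewrite /= eqxx.
Qed.

Lemma pastT n : past n setT.
Proof. by exists (fun=> setT) => //; apply/seteqP; split. Qed.

Lemma past_measurable n : past n `<=` measurable.
Proof.
move=> _ [B mB ->]; apply: bigcap_measurableType => i _.
by rewrite -[X in measurable X]setTI; exact: measurable_funPT.
Qed.

Lemma independent_initial n (B : nat -> set R) : independent theta ->
  (forall i, measurable (B i)) ->
  P (\bigcap_(i in `I_n) (theta i @^-1` B i)) =
  (\prod_(0 <= i < n) P (theta i @^-1` B i))%E.
Proof.
move=> ind mB.
pose J := [fset i in iota 0 n]%fset.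
have -> : `I_n = [set` J].
  by apply/seteqP; split => i /=; rewrite !inE mem_iota.
rewrite (ind J B mB); apply: perm_big; apply: uniq_perm.
- exact: fset_uniq.
- exact: iota_uniq.
- by move=> i; rewrite !inE mem_index_iota mem_iota.
Qed.

Lemma past_independent n A B : independent theta -> past n A -> measurable B ->
  P (A `&` theta n @^-1` B) = (P A * P (theta n @^-1` B))%E.
Proof.
move=> ind [C mC ->] mB.
(* Merges both events into one cylinder on [n + 1] angles, whose last factor in the product formula
   is the event at [n]. *)
pose D i := if i == n then B else C i.
have mD i : measurable (D i) by rewrite /D; case: ifP.
have Dlt i : (i < n)%N -> D i = C i by rewrite /D; case: ltngtP.
rewrite [X in P X](_ : _ = \bigcap_(i in `I_n.+1) (theta i @^-1` D i)).
  rewrite !independent_initial// big_nat_recr//= /D eqxx; congr (_ * _)%E.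
  by apply: eq_big_nat => i /andP[_ /Dlt]; rewrite /D => ->.
apply/seteqP; split => w /=.
  move=> [Cw Bw] i; rewrite /= ltnS leq_eqVlt => /orP[/eqP ->|iltn].
    by rewrite /D eqxx.
  by rewrite Dlt//; exact: Cw.
move=> Dw; split; last by have := Dw n (ltnSn n); rewrite /D eqxx.
by move=> i /= iltn; have := Dw i (ltnW iltn); rewrite /= Dlt.
Qed.

End Past.

(** * Geometric decay of long excursions *)

Section Excursion.
Context (R : realType) (S : ptopologicalType).
Variable act : 'M[R]_2 -> moduli R S -> moduli R S.
Hypothesis act_SL2 : is_SL2_action act.
Variables (kappa : seq nat) (Q : set (moduli R S)).
Hypothesis Q_comp : stratum_component kappa Q.
Variables (V : R -> moduli R S -> R) (delta : R).
Hypothesis V_family : drift_family act Q V.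
Hypothesis delta01 : 0 < delta < 1.
Variables (tau l gamma : R).
Hypotheses (l_gt0 : 0 < l) (gamma_ge0 : 0 <= gamma).
Hypothesis contraction : forall x, Q x -> l < V delta x ->
  (\int[nu R]_t (V delta (act (geo tau *m Defs.rot t) x))%:E
    <= (gamma * V delta x)%:E)%E.
Context d (Omega : measurableType d) (P : probability Omega R).
Variable theta : nat -> {RV P >-> R}.
Hypothesis theta_iid : iid_nu theta.
Variable q : moduli R S.
Hypothesis Qq : Q q.

Let X := walk act (fun k => theta k) tau q.

Let M n w := walk_mx (fun k => theta k) tau n w.

Let XE n w : X n w = act (M n w) q.
Proof. exact: walkE. Qed.

Let QX n w : Q (X n w).
Proof.
by elim: n => [//|n IH] /=; apply: component_geo_rot Q_comp _ _ _ IH.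
Qed.

Let V_ge0 n w : 0 <= V delta (X n w).
Proof. by apply/ltW; apply: (V_gt0 V_family delta01); exact: QX. Qed.

Definition outside n : set Omega := [set w | forall j, (j <= n)%N ->
  ~ sublevel Q V delta l (walk act (fun k => theta k) tau q j w)].

Lemma outsideE n :
  outside n = \bigcap_(j in `I_n.+1) [set w | l < V delta (X j w)].
Proof.
apply/seteqP; split => w /= H j jn.
  rewrite /= ltNge; apply/negP => Vl.
  by apply: (H j jn); split => //; exact: QX.
by move=> [_ /=]; apply/negP; rewrite -ltNge; exact: (H j).
Qed.

Lemma outsideS n : outside n.+1 `<=` outside n.
Proof. by move=> w H j /leqW; exact: H. Qed.

(** [Omega] with the sigma-algebra of the first n angles, for which the integrand in the freezing
    lemma must be measurable. *)
Let Past n : measurableType (past theta n).-sigma :=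
  g_sigma_algebraType (past theta n).

Let measurable_theta n k : (k < n)%N ->
  measurable_fun setT (theta k : Past n -> R).
Proof.
move=> kn _ B mB; rewrite setTI; apply: sub_sigma_algebra.
exact: past_preimage.
Qed.

Let measurable_M n k : (k <= n)%N ->
  forall i j, measurable_fun setT ((fun w => M k w i j) : Past n -> R).
Proof.
move=> kn; apply: (@measurable_walk_mx _ _ (Past n) (fun k => theta k)) => i ik.
by apply: measurable_theta; exact: leq_trans kn.
Qed.

Let measurable_VX n k : (k <= n)%N ->
  measurable_fun setT ((fun w => V delta (X k w)) : Past n -> R).
Proof.
move=> kn; under eq_fun do rewrite XE.
apply: (measurable_V_act V_family delta01 Qq).
- exact: measurable_M.
- by move=> w; exact: walk_mx_SL2.
Qed.

Lemma past_outside n : measurable (outside n : set (Past n)).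
Proof.
rewrite outsideE; apply: bigcap_measurableType => j /=; rewrite ltnS => jn.
rewrite -[X in measurable X]setTI -(preimage_itvoy _ l).
by apply: (measurable_VX jn) => //; exact: measurable_itv.
Qed.

Let measurable_V k : measurable_fun setT (fun w => V delta (X k w)).
Proof.
exact: (measurable_fun_generated (@past_measurable _ _ _ _ theta k)
  (measurable_VX (leqnn k))).
Qed.

Lemma measurable_outside n : measurable (outside n).
Proof.
apply: (generated_measurable (G := past theta n)); first exact: past_measurable.
exact: past_outside.
Qed.

(** The expectation of [V] along the walk killed on entering the sublevel set. *)
Definition mass n : \bar R :=
  (\int[P]_w (\1_(outside n) w * V delta (X n w))%:E)%E.

(** The event is enlarged from [outside n.+1] to [outside n], which depends on the first n angles
    only. Then [theta n] is integrated out with the past frozen, and [contraction] applies at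
    [X n w]. *)
Lemma massS n : (mass n.+1 <= gamma%:E * mass n)%E.
Proof.
pose oP : set (Past n) := outside n.
have moP : measurable oP by exact: past_outside.
pose f (z : Past n * R) : \bar R :=
  (\1_oP z.1 * V delta (act (geo tau *m Defs.rot z.2 *m M n z.1) q))%:E.
have mN (i j : 'I_2) : measurable_fun setT
    (fun z : Past n * R => (geo tau *m Defs.rot z.2 *m M n z.1) i j).
  apply: measurable_mulmx => {}i {}j.
    apply: measurable_mulmx => {}i {}j; first exact: measurable_cst.
    by apply: measurable_rot; exact: measurable_snd.
  apply: (@measurableT_comp _ _ _ _ _ _ (fun w : Past n => M n w i j)).
    exact: measurable_M.
  exact: measurable_fst.
have SLN (z : Past n * R) : SL2 (geo tau *m Defs.rot z.2 *m M n z.1).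
  apply: SL2_mul (walk_mx_SL2 _ _ _ _).
  by apply: SL2_mul; [exact: geo_SL2|exact: rot_SL2].
have mV : measurable_fun setT (fun z : Past n * R =>
    V delta (act (geo tau *m Defs.rot z.2 *m M n z.1) q)).
  exact: (measurable_V_act V_family delta01 Qq).
have mf : measurable_fun setT f.
  apply/measurable_EFinP/measurable_funM => //.
  apply: (@measurableT_comp _ _ _ _ _ _ (\1_oP : Past n -> R)).
    exact: measurable_indic.
  exact: measurable_fst.
have VE w t : V delta (act (geo tau *m Defs.rot t *m M n w) q) =
              V delta (act (geo tau *m Defs.rot t) (X n w)).
  rewrite XE -(actM act_SL2) //; last exact: walk_mx_SL2.
  by apply: SL2_mul; [exact: geo_SL2|exact: rot_SL2].
have f0 z : (0 <= f z)%E.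
  rewrite lee_fin mulr_ge0// VE; apply/ltW/(V_gt0 V_family delta01).
  by apply: component_geo_rot Q_comp _ _ _ _ => //; exact: QX.
have m1V k j : measurable_fun setT
    (fun w => (\1_(outside k) w * V delta (X j w))%:E).
  apply/measurable_EFinP/measurable_funM; last exact: measurable_V.
  exact: (measurable_indic (measurable_outside k)).
have fE w : f (w, theta n w) = (\1_(outside n) w * V delta (X n.+1 w))%:E.
  by rewrite /f /= VE.
apply: (@le_trans _ _ (\int[P]_w f (w, theta n w))%E).
  under [leRHS]eq_integral do rewrite fE.
  apply: ge0_le_integral => //.
  - by move=> w _; rewrite lee_fin mulr_ge0.
  - move=> w _; rewrite lee_fin; apply: ler_wpM2r => //.
    rewrite !indicE ler_nat; case: (boolP (w \in outside n.+1)) => //.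
    by rewrite inE => /outsideS wo; rewrite mem_set.
rewrite (integral_independent (@pastI _ _ _ _ theta n) (@pastT _ _ _ _ theta n)
  (@past_measurable _ _ _ _ theta n) (m := nu R))//; last 2 first.
- exact: (measurable_funPT (theta n)).
- move=> A B pA mB; rewrite (past_independent theta_iid.1 pA mB).
  by rewrite theta_iid.2.
rewrite /mass -ge0_integralZl//; last by move=> w _; rewrite lee_fin mulr_ge0.
apply: ge0_le_integral => //.
- by move=> w _; exact: integral_ge0.
- have mF : measurable_fun setT
      ((fun w => \int[nu R]_t f (w, t))%E : Past n -> _).
    exact: measurable_fun_fubini_tonelli_F.
  exact: (measurable_fun_generated (@past_measurable _ _ _ _ theta n) mF).
- exact: measurable_funeM.
(* Off [outside n] both sides vanish; on it [V delta (X n w)] exceeds [l], as [contraction]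
   demands. *)
- move=> w _; rewrite /f /=.
  have [wo|wo] := boolP (w \in oP); last first.
    rewrite indicE (negbTE wo); under eq_integral do rewrite mul0r.
    by rewrite integral0 mul0r mule0.
  rewrite indicE wo; under eq_integral do rewrite mul1r VE.
  rewrite mul1r -EFinM; apply: contraction => //.
  by move: wo; rewrite inE /oP outsideE => /(_ n (ltnSn n)).
Qed.

Lemma mass_le n : (mass n <= (gamma ^+ n * V delta q)%:E)%E.
Proof.
elim: n => [|n IH].
  have -> : (gamma ^+ 0 * V delta q)%:E = (\int[P]_w (cst (V delta q)%:E) w)%E.
    rewrite integral_cst// expr0 mul1r -[LHS]mule1; congr (_ * _)%E.
    exact/esym/probability_setT.
  rewrite /mass; apply: ge0_le_integral => //.
  - by move=> w _; rewrite lee_fin mulr_ge0// (V_ge0 0 w).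
  - apply/measurable_EFinP/measurable_funM; last exact: (measurable_V 0).
    exact: (measurable_indic (measurable_outside 0)).
  - move=> w _; rewrite lee_fin -[leRHS]mul1r; apply: ler_wpM2r.
      exact: (V_ge0 0 w).
    by rewrite indicE lern1 leq_b1.
apply: le_trans (massS n) _; rewrite exprS -mulrA EFinM.
by apply: lee_wpmul2l.
Qed.

Lemma probability_outside n :
  (P (outside n) <= (V delta q / l * gamma ^+ n)%:E)%E.
Proof.
(* Markov's inequality in integral form: [l] times the indicator is at most the integrand of
   [mass n]. *)
have -> : V delta q / l * gamma ^+ n = l^-1 * (gamma ^+ n * V delta q) by ring.
rewrite EFinM lee_pdivlMl//; apply: le_trans (mass_le n).
have mo := measurable_outside n.
have m1 : measurable_fun setT (fun w => (\1_(outside n) w)%:E : \bar R).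
  by apply/measurable_EFinP; exact: measurable_indic.
have -> : P (outside n) = (\int[P]_w (\1_(outside n) w)%:E)%E.
  by rewrite integral_indic// setIT.
rewrite -ge0_integralZl//; last by rewrite lee_fin ltW.
apply: ge0_le_integral => //.
- by move=> w _; rewrite -EFinM lee_fin mulr_ge0// ltW.
- exact: measurable_funeM.
- apply/measurable_EFinP/measurable_funM; last exact: measurable_V.
  exact: measurable_indic.
move=> w _; rewrite -EFinM lee_fin; have [wo|wo] := boolP (w \in outside n).
  rewrite indicE wo mulr1 mul1r; apply/ltW.
  by move: wo; rewrite inE outsideE => /(_ n (ltnSn n)).
by rewrite indicE (negbTE wo) mulr0 mul0r.
Qed.

End Excursion.

(** * Choice of the constants *)

Unset Implicit Arguments.

Theorem theorem2p5 (R : realType) (g : nat) (g_ge2 : (2 <= g)%N)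
  (S : ptopologicalType) (S_genus : genus_surface R g S)
  (kappa : seq nat) (kappa_pos : all (fun k => 0 < k)%N kappa)
  (kappa_sum : sumn kappa = (4 * g - 4)%N)
  (act : 'M[R]_2 -> moduli R S -> moduli R S)
  (act_SL2 : is_SL2_action act)
  (Q : set (moduli R S)) (Q_comp : stratum_component kappa Q)
  (V : R -> moduli R S -> R) (V_family : drift_family act Q V)
  (delta : R) (delta01 : 0 < delta < 1) :
  exists2 tau0 : R, 0 < tau0 &
  exists gamma : R -> R,
  forall tau : R, tau0 < tau ->
  exists l0 : R,
  forall l : R, l0 < l ->
  gamma l < 1 /\
  forall q : moduli R S, Q q -> ~ sublevel Q V delta l q ->
  forall n : nat, (1 <= n)%N ->
  forall (d : measure_display) (Omega : measurableType d)
    (P : probability Omega R) (theta : nat -> {RV P >-> R}),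
  iid_nu theta ->
  (P [set w | forall j : nat, (j <= n)%N ->
        ~ sublevel Q V delta l (walk act (fun k => theta k) tau q j w)]
    <= (V delta q / l * gamma l ^+ n)%:E)%E.
Proof.
have [c [tau1 drift]] := V_drift V_family delta01.
have /andP[delta0 delta1] := delta01.
(* The entry 1 makes [tau0] positive, [tau1] makes the drift inequality available, and the last one
   gives [4 * |c| < (1 - delta) * tau], which is below [expR ((1 - delta) * tau)]. *)
pose tau0 := Num.max (Num.max 1 tau1) (4 * `|c| / (1 - delta)).
exists tau0; first by rewrite !lt_max ltr01.
(* One constant serves all [l] and [tau]: the multiplicative and the additive drift terms contribute
   1/4 each. *)
exists (fun=> 1 / 2) => tau.
rewrite !gt_max -andbA => /and3P[tau_gt1 tau_tau1 tau_c].
have [b drift_b] := drift _ tau_tau1.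
exists (4 * `|b|) => l lb; split; first by lra.
have l0 : 0 < l by apply: le_lt_trans lb; rewrite mulr_ge0.
move=> q Qq _ n _ d Omega P theta theta_iid.
apply: (probability_outside act_SL2 Q_comp V_family delta01) => // x Qx lx.
apply: le_trans (drift_b x Qx) _; rewrite lee_fin.
have Vx0 : 0 < V delta x by exact: lt_trans lx.
have eps0 : 0 < 1 - delta by rewrite subr_gt0.
have c_le : c * expR (- (1 - delta) * tau) <= 1 / 4.
  rewrite mulNr expRN ler_pdivrMr ?expR_gt0//.
  have := expR_ge1Dx ((1 - delta) * tau).
  move: tau_c; rewrite ltr_pdivrMr// => tau_c.
  have := ler_norm c; lra.
have b_le : b <= 1 / 4 * V delta x by have := ler_norm b; lra.
have : c * expR (- (1 - delta) * tau) * V delta x <= 1 / 4 * V delta x.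
  by rewrite ler_wpM2r// ltW.
lra.
Qed.
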